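(* Let $A$ be a real $m\times n$ matrix and $B$ a real $n\times\rho$ matrix, let $c\ge1$ be an integer, and let $\Theta^{(\kappa)}=\{\Theta^{(\kappa)}_1,\ldots,\Theta^{(\kappa)}_k\}$ be any partition of $\{1,\ldots,n\}$ coarser than the finest partition $\Theta=\{\{1\},\ldots,\{n\}\}$. Assume that the optimal probabilities $p^{(\kappa)}$ of $\Theta^{(\kappa)}$ and $p^{(o)}$ of $\Theta$ are sampling probabilities (i.e. have all entries positive). Let $V_{p^{(\kappa)}}(AB)$ and $V_{p^{(o)}}(AB)$ be the expected values of the squared Frobenius-norm error $\|AB-\hat S\|_F^2$ when $AB$ is approximated with $c$ independent trials based on $\Theta^{(\kappa)}$ with probability $p^{(\kappa)}$ and based on $\Theta$ with probability $p^{(o)}$, respectively. Then $$V_{p^{(\kappa)}}(AB)\le V_{p^{(o)}}(AB).$$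
   Context: For a partition $\{\Theta_1,\ldots,\Theta_k\}$ of $\{1,\ldots,n\}$ into nonempty blocks, $A_{(,\Theta_\ell)}$ is the matrix formed by the columns of $A$ with indices in $\Theta_\ell$ and $B_{(\Theta_\ell,)}$ the matrix formed by the rows of $B$ with indices in $\Theta_\ell$ (same ordering); $A_{(,\ell)}$ and $B_{(\ell,)}$ denote the $\ell$th column of $A$ and $\ell$th row of $B$. A sampling probability is a vector $p=(p_\ell)_{\ell=1}^k$ with $p_\ell>0$ and $\sum_\ell p_\ell=1$. Approximating $AB$ with $c$ independent trials based on this partition with probability $p$ means forming $$\hat S=\frac1c\sum_{i=1}^c\frac1{p_{r_i}}A_{(,\Theta_{r_i})}B_{(\Theta_{r_i},)},$$ where $r_1,\ldots,r_c$ are independent samples from $\{1,\ldots,k\}$ drawn according to $p$. The optimal probabilities are $$p^{(\kappa)}_\ell=\frac{\|A_{(,\Theta^{(\kappa)}_\ell)}B_{(\Theta^{(\kappa)}_\ell,)}\|_F}{\sum_{j=1}^k\|A_{(,\Theta^{(\kappa)}_j)}B_{(\Theta^{(\kappa)}_j,)}\|_F}\ (1\le\ell\le k),\qquad p^{(o)}_\ell=\frac{\|A_{(,\ell)}\|_F\|B_{(\ell,)}\|_F}{\sum_{j=1}^n\|A_{(,j)}\|_F\|B_{(j,)}\|_F}\ (1\le\ell\le n).$$ $\|\cdot\|_F$ is the Frobenius norm (Euclidean norm for a single row or column). *)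

(* Defs.v *)
From HB Require Import structures.
From mathcomp Require Import all_boot all_order all_algebra.
From mathcomp Require Import all_classical all_reals all_analysis.

Set Implicit Arguments.
Unset Strict Implicit.
Unset Printing Implicit Defensive.

Import Order.TTheory GRing.Theory Num.Theory.

Local Open Scope ring_scope.

(* The norm `|A| provided by the library on matrices is the sup norm. *)
Definition frobenius_norm (R : realType) (m n : nat) (A : 'M[R]_(m, n)) : R :=
  Num.sqrt (\sum_i \sum_j A i j ^+ 2).

(* Injectivity rules out repeated blocks, which the image set would hide. *)
Definition is_indexed_partition (n k : nat) (Theta : 'I_k -> {set 'I_n}) : Prop :=
  injective Theta /\
  finset.partition [set Theta l | l : 'I_k]%SET [set: 'I_n]%SET.

Definition finest_partition (n : nat) : 'I_n -> {set 'I_n} :=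
  fun l => [set l]%SET.

Definition coarser (n k k' : nat) (Theta : 'I_k -> {set 'I_n})
    (Theta' : 'I_k' -> {set 'I_n}) : Prop :=
  forall l' : 'I_k', exists l : 'I_k, Theta' l' \subset Theta l.

(* enum_val enumerates I in increasing order, so the order of the columns
   (of the rows) is kept. *)
Definition cols_in (R : realType) (m n : nat) (A : 'M[R]_(m, n))
    (I : {set 'I_n}) : 'M[R]_(m, #|I|) :=
  colsub (fun i : 'I_#|I| => enum_val i) A.

Definition rows_in (R : realType) (n q : nat) (B : 'M[R]_(n, q))
    (I : {set 'I_n}) : 'M[R]_(#|I|, q) :=
  rowsub (fun i : 'I_#|I| => enum_val i) B.

Definition is_sampling_probability (R : realType) (k : nat) (p : 'I_k -> R) :
    Prop :=
  (forall l, 0 < p l) /\ \sum_l p l = 1.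

Definition optimal_probability (R : realType) (m n q k : nat)
    (A : 'M[R]_(m, n)) (B : 'M[R]_(n, q)) (Theta : 'I_k -> {set 'I_n}) :
    'I_k -> R :=
  fun l => frobenius_norm (cols_in A (Theta l) *m rows_in B (Theta l)) /
    \sum_j frobenius_norm (cols_in A (Theta j) *m rows_in B (Theta j)).

Definition optimal_probability_finest (R : realType) (m n q : nat)
    (A : 'M[R]_(m, n)) (B : 'M[R]_(n, q)) : 'I_n -> R :=
  fun l => frobenius_norm (col l A) * frobenius_norm (row l B) /
    \sum_j frobenius_norm (col j A) * frobenius_norm (row j B).

Definition sampled_product (R : realType) (m n q k c : nat)
    (A : 'M[R]_(m, n)) (B : 'M[R]_(n, q)) (Theta : 'I_k -> {set 'I_n})
    (p : 'I_k -> R) (r : 'I_c -> 'I_k) : 'M[R]_(m, q) :=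
  c%:R^-1 *: \sum_(i < c)
    (p (r i))^-1 *: (cols_in A (Theta (r i)) *m rows_in B (Theta (r i))).

Local Open Scope classical_set_scope.

(* 'I_k carries the discrete sigma-algebra: every set of indices is an event.
   For finitely many variables, the product rule over all families E contains
   the one over subfamilies (take E i = setT). *)
Definition independent_samples (R : realType) (d : measure_display)
    (Omega : measurableType d) (P : probability Omega R) (k c : nat)
    (p : 'I_k -> R) (r : 'I_c -> Omega -> 'I_k) : Prop :=
  [/\ forall (i : 'I_c) (E : set 'I_k), measurable (r i @^-1` E),
      forall (i : 'I_c) (l : 'I_k), P (r i @^-1` [set l]) = (p l)%:E &
      forall E : 'I_c -> set 'I_k,
        P (\bigcap_i (r i @^-1` E i)) = (\prod_i P (r i @^-1` E i))%E].

Definition expected_sq_error (R : realType) (d : measure_display)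
    (Omega : measurableType d) (P : probability Omega R) (m n q k c : nat)
    (A : 'M[R]_(m, n)) (B : 'M[R]_(n, q)) (Theta : 'I_k -> {set 'I_n})
    (p : 'I_k -> R) (r : 'I_c -> Omega -> 'I_k) : \bar R :=
  'E_P[fun w => frobenius_norm
         (A *m B - sampled_product A B Theta p (fun i => r i w)) ^+ 2].

(* Main.v *)
Require Import Defs.
From HB Require Import structures.
From mathcomp Require Import all_boot all_order all_algebra.
From mathcomp Require Import all_classical all_reals all_analysis.
From mathcomp Require Import measurable_realfun ring.

Set Implicit Arguments.
Unset Strict Implicit.
Unset Printing Implicit Defensive.

Import Order.TTheory GRing.Theory Num.Theory.

(** Write N_l for the Frobenius norm of the block product M_l of the columns and
    rows indexed by the l-th block.  The estimator is the mean of c independent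
    copies of the random matrix M_l / p_l, and the M_l add up to AB, so it is
    unbiased.  Its expected squared error, a sum of variances over the entries,
    is therefore
      c^-1 * (sum_l N_l^2 / p_l - |AB|^2)          ([expected_sq_errorE]).
    For the optimal probabilities p_l = N_l / S with S = sum_j N_j, this
    becomes c^-1 * (S^2 - |AB|^2)           ([expected_sq_error_optimal]).

    Two partitions thus compare as the sums S of their block norms do.  A block
    product is the sum over t in the block of the outer products of column t of
    A and row t of B; the norm of each outer product is the product of the norms
    of its factors, that is, the block norm of the finest partition.  The
    triangle inequality, summed over the blocks, says that merging indices into
    blocks cannot increase S. *)

(** * The Frobenius norm *)

Section Frobenius.
Local Open Scope ring_scope.
Variable R : realType.

Lemma frobenius_norm_ge0 m n (A : 'M[R]_(m, n)) : 0 <= frobenius_norm A.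
Proof. exact: sqrtr_ge0. Qed.

Lemma frobenius_norm_sqr m n (A : 'M[R]_(m, n)) :
  frobenius_norm A ^+ 2 = \sum_i \sum_j A i j ^+ 2.
Proof.
by rewrite sqr_sqrtr// sumr_ge0// => i _; apply: sumr_ge0 => j _; apply: sqr_ge0.
Qed.

Lemma frobenius_norm0 m n : frobenius_norm (0 : 'M[R]_(m, n)) = 0.
Proof.
rewrite /frobenius_norm big1 ?sqrtr0// => i _; rewrite big1// => j _.
by rewrite mxE expr0n.
Qed.

Lemma frobenius_norm_eq0 m n (A : 'M[R]_(m, n)) : frobenius_norm A = 0 -> A = 0.
Proof.
move=> A0; have /eqP := frobenius_norm_sqr A; rewrite A0 expr0n eq_sym.
have nn i : true -> 0 <= \sum_j A i j ^+ 2.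
  by move=> _; apply: sumr_ge0 => j _; apply: sqr_ge0.
rewrite psumr_eq0// => /allP h; apply/matrixP => i j; rewrite mxE.
have /= := h i (mem_index_enum i).
rewrite psumr_eq0; last by move=> ? _; apply: sqr_ge0.
by move=> /allP/(_ j (mem_index_enum j)) /=; rewrite sqrf_eq0 => /eqP.
Qed.

(** With a = |A| and b = |B|, expanding the nonnegative sum of the squares
    (b A_ij - a B_ij)^2 gives 2ab (ab - <A, B>) >= 0. *)
Lemma frobenius_cauchy_schwarz m n (A B : 'M[R]_(m, n)) :
  \sum_i \sum_j A i j * B i j <= frobenius_norm A * frobenius_norm B.
Proof.
set a := frobenius_norm A; set b := frobenius_norm B.
have a0 : 0 <= a := frobenius_norm_ge0 A.
have b0 : 0 <= b := frobenius_norm_ge0 B.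
have [aE|an0] := eqVneq a 0.
  rewrite (frobenius_norm_eq0 aE) aE mul0r big1// => i _.
  by rewrite big1// => j _; rewrite mxE mul0r.
have [bE|bn0] := eqVneq b 0.
  rewrite (frobenius_norm_eq0 bE) bE mulr0 big1// => i _.
  by rewrite big1// => j _; rewrite mxE mulr0.
have ab : 0 < a * b by rewrite mulr_gt0// lt_def ?an0 ?bn0.
set s := \sum_i _.
have : 0 <= \sum_i \sum_j (b * A i j - a * B i j) ^+ 2.
  by apply: sumr_ge0 => i _; apply: sumr_ge0 => j _; apply: sqr_ge0.
have -> : \sum_i \sum_j (b * A i j - a * B i j) ^+ 2 =
    b ^+ 2 * (\sum_i \sum_j A i j ^+ 2) + a ^+ 2 * (\sum_i \sum_j B i j ^+ 2)
    - 2 * (a * b) * s.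
  rewrite /s !mulr_sumr -big_split -sumrB; apply: eq_bigr => i _ /=.
  rewrite !mulr_sumr -big_split -sumrB; apply: eq_bigr => j _ /=; ring.
rewrite -!frobenius_norm_sqr -/a -/b.
have -> : b ^+ 2 * a ^+ 2 + a ^+ 2 * b ^+ 2 - 2 * (a * b) * s =
   2 * (a * b) * (a * b - s) by ring.
by rewrite pmulr_rge0 ?subr_ge0// mulr_gt0.
Qed.

Lemma frobenius_normD m n (A B : 'M[R]_(m, n)) :
  frobenius_norm (A + B) <= frobenius_norm A + frobenius_norm B.
Proof.
rewrite -(@ler_pXn2r _ 2)// ?nnegrE ?addr_ge0 ?frobenius_norm_ge0//.
rewrite sqrrD !frobenius_norm_sqr.
have -> : \sum_i \sum_j (A + B) i j ^+ 2 = \sum_i \sum_j A i j ^+ 2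
    + (\sum_i \sum_j A i j * B i j) *+ 2 + \sum_i \sum_j B i j ^+ 2.
  rewrite -sumrMnl -!big_split; apply: eq_bigr => i _ /=.
  rewrite -sumrMnl -!big_split; apply: eq_bigr => j _ /=; rewrite mxE; ring.
by rewrite lerD2r lerD2l lerMn2r frobenius_cauchy_schwarz orbT.
Qed.

Lemma frobenius_norm_sum m n (I : finType) (D : {pred I}) (F : I -> 'M[R]_(m, n)) :
  frobenius_norm (\sum_(i in D) F i) <= \sum_(i in D) frobenius_norm (F i).
Proof.
elim/big_rec2: _ => [|i y x _ le_xy]; first by rewrite frobenius_norm0.
exact: le_trans (frobenius_normD _ _) (lerD _ _).
Qed.

(** The equality in the rank-one case makes the finest partition the one whose
    block norms are the products |A_(,t)| |B_(t,)|. *)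
Lemma frobenius_norm_outer m n (u : 'cV[R]_m) (v : 'rV[R]_n) :
  frobenius_norm (u *m v) = frobenius_norm u * frobenius_norm v.
Proof.
rewrite /frobenius_norm -sqrtrM; last first.
  by apply: sumr_ge0 => i _; apply: sumr_ge0 => j _; apply: sqr_ge0.
congr Num.sqrt; rewrite [in X in _ * X]big_ord1 mulr_suml.
apply: eq_bigr => i _; rewrite big_ord1 mulr_sumr; apply: eq_bigr => j _.
by rewrite mxE big_ord1 exprMn.
Qed.

End Frobenius.

(** * Block products along a partition *)

Section Blocks.
Local Open Scope ring_scope.
Variables (R : realType) (m n q : nat) (A : 'M[R]_(m, n)) (B : 'M[R]_(n, q)).

Lemma block_mulmx (I : {set 'I_n}) :
  cols_in A I *m rows_in B I = \sum_(t in I) col t A *m row t B.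
Proof.
apply/matrixP => a b; rewrite big_enum_val summxE mxE; apply: eq_bigr => i _.
by rewrite !mxE big_ord1 !mxE.
Qed.

Lemma sum_indexed_partition (V : nmodType) k (Theta : 'I_k -> {set 'I_n})
    (F : 'I_n -> V) : is_indexed_partition Theta ->
  \sum_l \sum_(t in Theta l) F t = \sum_t F t.
Proof.
move=> [injT /and3P[/eqP covT trivT _]].
transitivity (\sum_(t in finset.cover [set Theta l | l : 'I_k]%SET) F t).
  rewrite finset.big_trivIset// finset.big_imset/=; last by move=> ? ? _ _ /injT.
  by apply: eq_bigl => l; rewrite inE.
by apply: eq_bigl => t; rewrite covT inE.
Qed.

Lemma sum_block_mulmx k (Theta : 'I_k -> {set 'I_n}) :
  is_indexed_partition Theta ->
  \sum_l cols_in A (Theta l) *m rows_in B (Theta l) = A *m B.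
Proof.
move=> hT; under eq_bigr do rewrite block_mulmx.
rewrite sum_indexed_partition//; apply/matrixP => a b.
by rewrite summxE mxE; apply: eq_bigr => t _; rewrite mxE big_ord1 !mxE.
Qed.

Lemma finest_indexed_partition : is_indexed_partition (@finest_partition n).
Proof.
split; first exact: finset.set1_inj.
apply/and3P; split.
- apply/eqP/finset.setP => t; rewrite finset.in_setT; apply/finset.bigcupP.
  by exists [set t]%SET; rewrite ?finset.set11// finset.imset_f.
- apply/finset.trivIsetP => _ _ /finset.imsetP[s _ ->] /finset.imsetP[t _ ->] st.
  rewrite finset.disjoints1 finset.in_set1.
  by apply: contraNneq st => ->.
- by apply/finset.imsetP => -[t _ /finset.setP/(_ t)]; rewrite !inE eqxx.
Qed.

Lemma frobenius_norm_finest_block t :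
  frobenius_norm (cols_in A (finest_partition t) *m rows_in B (finest_partition t))
  = frobenius_norm (col t A) * frobenius_norm (row t B).
Proof. by rewrite block_mulmx finset.big_set1 frobenius_norm_outer. Qed.

Lemma optimal_probability_finestE :
  optimal_probability_finest A B = optimal_probability A B (@finest_partition n).
Proof.
apply/funext => t; rewrite /optimal_probability frobenius_norm_finest_block.
by under [in RHS]eq_bigr do rewrite frobenius_norm_finest_block.
Qed.

End Blocks.

(** * Variance of a sample mean *)

Section Samples.
Local Open Scope ring_scope.
Variables (R : realType) (k c : nat) (p : 'I_k -> R).

Hypothesis p1 : \sum_l p l = 1.

(** Independence in finite form: the sum over all samples f factors into a
    product over the draws.  Draws other than i and j contribute the total mass
    1; for distinct i and j the factor at i is the mean of y, which vanishes. *)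
Lemma mean_pair (y : 'I_k -> R) (y0 : \sum_l p l * y l = 0) (i j : 'I_c) :
  \sum_(f : {ffun 'I_c -> 'I_k}) (\prod_s p (f s)) * (y (f i) * y (f j)) =
  (\sum_l p l * y l ^+ 2) *+ (i == j).
Proof.
pose F s l := p l * ((if s == i then y l else 1) * (if s == j then y l else 1)).
(* The weights F keep y at the positions i and j; at i = j both factors appear. *)
transitivity (\prod_s \sum_l F s l).
  rewrite bigA_distr_bigA; apply: eq_bigr => f _; rewrite !big_split /=.
  by rewrite -!big_mkcond !big_pred1_eq.
rewrite (bigD1 i)//= /F eqxx.
have [<-|ij] := eqVneq i j.
  rewrite [X in _ * X]big1 ?mulr1.
    by apply: eq_bigr => l _; rewrite expr2.
  move=> s /negbTE si; rewrite -[RHS]p1.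
  by apply: eq_bigr => l _; rewrite si !mulr1.
by under eq_bigr do rewrite mulr1; rewrite y0 mul0r.
Qed.

(** The error of the sample mean is the sample mean of the centred variable
    y = mu - z; of the c^2 pairs of draws in its square, only the c diagonal ones
    survive, whence the factor c^-1. *)
Lemma sample_mean_variance (z : 'I_k -> R) : (0 < c)%N ->
  \sum_(f : {ffun 'I_c -> 'I_k}) (\prod_s p (f s)) *
     (\sum_l p l * z l - c%:R^-1 * \sum_s z (f s)) ^+ 2 =
  c%:R^-1 * (\sum_l p l * z l ^+ 2 - (\sum_l p l * z l) ^+ 2).
Proof.
move=> c0; have cn0 : c%:R != 0 :> R by rewrite pnatr_eq0 -lt0n.
set mu := \sum_l p l * z l; pose y l := mu - z l.
have y0 : \sum_l p l * y l = 0.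
  under eq_bigr do rewrite mulrBr.
  by rewrite sumrB -mulr_suml p1 mul1r subrr.
have yy : \sum_l p l * y l ^+ 2 = \sum_l p l * z l ^+ 2 - mu ^+ 2.
  transitivity (\sum_l (p l * mu ^+ 2 - (2 * mu) * (p l * z l) + p l * z l ^+ 2)).
    by apply: eq_bigr => l _; rewrite /y; ring.
  rewrite big_split sumrB /= -mulr_suml -mulr_sumr p1 -/mu; ring.
transitivity (c%:R^-1 ^+ 2 * \sum_(i < c) \sum_(j < c)
    \sum_(f : {ffun 'I_c -> 'I_k}) (\prod_s p (f s)) * (y (f i) * y (f j))).
  under [in RHS]eq_bigr do rewrite exchange_big /=.
  rewrite exchange_big mulr_sumr /=; apply: eq_bigr => f _.
  have -> : mu - c%:R^-1 * \sum_s z (f s) = c%:R^-1 * \sum_s y (f s).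
    by rewrite sumrB sumr_const card_ord mulrBr -(mulr_natl mu) mulKf.
  rewrite exprMn mulrCA expr2 [X in _ * (_ * X)]mulr_suml.
  congr *%R; rewrite mulr_sumr; apply: eq_bigr => i _.
  by rewrite mulrA !mulr_sumr; apply: eq_bigr => j _; rewrite mulrA.
under eq_bigr do under eq_bigr do rewrite mean_pair//.
set v := \sum_l p l * y l ^+ 2.
have diag (i : 'I_c) : \sum_(j < c) v *+ (i == j) = v.
  rewrite (bigD1 i)//= eqxx big1 ?addr0// => j /negbTE ji.
  by rewrite eq_sym ji.
under eq_bigr do rewrite diag.
by rewrite sumr_const card_ord -yy -/v -(mulr_natl v) expr2 -mulrA mulKf.
Qed.
End Samples.

(** * Expected squared error *)

Section Expectation.
Local Open Scope classical_set_scope.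
Local Open Scope ring_scope.
Variables (R : realType) (k c : nat) (p : 'I_k -> R).
Variables (d : measure_display) (Omega : measurableType d).
Variables (P : probability Omega R) (r : 'I_c -> Omega -> 'I_k).

(** The events on which the joint sample takes a given value f partition the
    probability space, so a function of the sample is a finite combination of
    their indicators, and independence evaluates their probabilities.  Working
    with nonnegative g avoids integrability side conditions. *)
Lemma expectation_independent_samples (g : {ffun 'I_c -> 'I_k} -> R) :
  independent_samples P p r -> (forall f, 0 <= g f) ->
  ('E_P[fun w => g [ffun i => r i w]])%E =
  (\sum_(f : {ffun 'I_c -> 'I_k}) (\prod_i p (f i)) * g f)%:E.
Proof.
move=> [mr law indep] g0.
pose D (f : {ffun 'I_c -> 'I_k}) := \bigcap_i (r i @^-1` [set f i]).
have mD f : measurable (D f) by apply: fin_bigcap_measurable => // i _; apply: mr.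
have PD f : P (D f) = (\prod_i p (f i))%:E.
  by rewrite /D (indep (fun i => [set f i])) -prodEFin; apply: eq_bigr => i _.
rewrite unlock.
transitivity (\int[P]_w (\sum_(f : {ffun 'I_c -> 'I_k}) (g f)%:E * (\1_(D f) w)%:E))%E.
  apply: eq_integral => w _.
  rewrite (bigD1 [ffun i => r i w])//= big1 ?adde0.
    by rewrite indicE mem_set ?mule1// => i _ /=; rewrite ffunE.
  move=> f fr; rewrite indicE memNset ?mule0// => Dfw.
  by case/eqP: fr; apply/ffunP => i; rewrite ffunE -(Dfw i).
rewrite ge0_integral_sum//; last 2 first.
- by move=> f; apply: measurable_funeM; apply/measurable_EFinP; apply: measurable_indic.
- by move=> f w _; rewrite mule_ge0// lee_fin.
rewrite -sumEFin; apply: eq_bigr => f _.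
rewrite ge0_integralZl_EFin//.
  by rewrite integral_indic// setIT EFinM -PD muleC.
by apply/measurable_EFinP; apply: measurable_indic.
Qed.

Variables (m n q : nat) (A : 'M[R]_(m, n)) (B : 'M[R]_(n, q)).
Variable Theta : 'I_k -> {set 'I_n}.
Hypotheses (c0 : (0 < c)%N) (hTheta : is_indexed_partition Theta).

Let N l := frobenius_norm (cols_in A (Theta l) *m rows_in B (Theta l)).

(** The variance of a sample mean, summed over the matrix entries; the block
    products sum to AB, which makes the estimator unbiased. *)
Lemma expected_sq_errorE :
  is_sampling_probability p -> independent_samples P p r ->
  expected_sq_error P A B Theta p r =
  (c%:R^-1 * (\sum_l N l ^+ 2 / p l - frobenius_norm (A *m B) ^+ 2))%:E.
Proof.
move=> [p0 p1] hr; pose M l := cols_in A (Theta l) *m rows_in B (Theta l).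
pose g (f : {ffun 'I_c -> 'I_k}) :=
  frobenius_norm (A *m B - sampled_product A B Theta p f) ^+ 2.
transitivity ('E_P[fun w => g [ffun i => r i w]])%E.
  congr expectation; apply/funext => w; rewrite /g.
  congr (frobenius_norm (_ - _) ^+ 2); congr (_ *: _).
  by apply: eq_bigr => i _; rewrite ffunE.
rewrite expectation_independent_samples//; last by move=> f; apply: sqr_ge0.
congr EFin.
(* Entrywise, the error is that of a sample mean of the variable z a b, whose
   mean is the entry of AB. *)
pose z a b l := (p l)^-1 * M l a b.
have zmu a b : \sum_l p l * z a b l = (A *m B) a b.
  rewrite -(sum_block_mulmx A B hTheta) summxE; apply: eq_bigr => l _.
  by rewrite /z mulVKf// gt_eqF.
have gE f : g f = \sum_a \sum_b
    (\sum_l p l * z a b l - c%:R^-1 * \sum_s z a b (f s)) ^+ 2.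
  rewrite /g frobenius_norm_sqr; apply: eq_bigr => a _; apply: eq_bigr => b _.
  rewrite zmu !mxE summxE; congr ((_ - _ * _) ^+ 2).
  by apply: eq_bigr => s _; rewrite mxE.
under eq_bigr do rewrite gE mulr_sumr; rewrite exchange_big /=.
under eq_bigr do under eq_bigr do rewrite mulr_sumr.
under eq_bigr do rewrite exchange_big /=.
under eq_bigr do under eq_bigr do rewrite sample_mean_variance//.
under eq_bigr do rewrite -mulr_sumr; rewrite -mulr_sumr; congr *%R.
rewrite frobenius_norm_sqr.
under [LHS]eq_bigr do rewrite sumrB; rewrite sumrB; congr (_ - _); last first.
  by apply: eq_bigr => a _; apply: eq_bigr => b _; rewrite zmu.
under [LHS]eq_bigr do rewrite exchange_big /=; rewrite exchange_big /=.
apply: eq_bigr => l _; rewrite /N frobenius_norm_sqr !mulr_suml.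
apply: eq_bigr => a _; rewrite mulr_suml; apply: eq_bigr => b _.
by rewrite /z exprMn expr2 mulrA mulVKf ?gt_eqF// mulrC.
Qed.

End Expectation.

Section Optimal.
Local Open Scope ring_scope.
Variables (R : realType) (m n q k c : nat).
Variables (A : 'M[R]_(m, n)) (B : 'M[R]_(n, q)).
Variable Theta : 'I_k -> {set 'I_n}.
Variables (d : measure_display) (Omega : measurableType d).
Variables (P : probability Omega R) (r : 'I_c -> Omega -> 'I_k).

(** Each term N_l^2 / p_l equals N_l S, so the sum of the second moments is
    S^2. *)
Lemma expected_sq_error_optimal : (0 < c)%N -> is_indexed_partition Theta ->
  is_sampling_probability (optimal_probability A B Theta) ->
  independent_samples P (optimal_probability A B Theta) r ->
  expected_sq_error P A B Theta (optimal_probability A B Theta) r =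
  (c%:R^-1 *
    ((\sum_l frobenius_norm (cols_in A (Theta l) *m rows_in B (Theta l))) ^+ 2
     - frobenius_norm (A *m B) ^+ 2))%:E.
Proof.
move=> c0 hT hp hr; rewrite (expected_sq_errorE _ _ c0 hT hp hr).
congr (_ * (_ - _))%:E; rewrite [RHS]expr2 mulr_suml; apply: eq_bigr => l _.
rewrite /optimal_probability invf_div; set N := frobenius_norm _.
by rewrite mulrCA; have [->|N0] := eqVneq N 0; rewrite ?expr0n ?mul0r ?mulr0 //
  expr2 mulfK // mulrC.
Qed.
End Optimal.

Theorem corollary2p5 (R : realType) (m n q c k : nat)
    (A : 'M[R]_(m, n)) (B : 'M[R]_(n, q)) (hc : (1 <= c)%N)
    (Theta : 'I_k -> {set 'I_n})
    (hTheta : is_indexed_partition Theta)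
    (hcoarser : coarser Theta (@finest_partition n))
    (hpk : is_sampling_probability (optimal_probability A B Theta))
    (hpo : is_sampling_probability (optimal_probability_finest A B))
    (d : measure_display) (Omega : measurableType d) (P : probability Omega R)
    (r : 'I_c -> Omega -> 'I_k)
    (hr : independent_samples P (optimal_probability A B Theta) r)
    (d' : measure_display) (Omega' : measurableType d')
    (P' : probability Omega' R) (r' : 'I_c -> Omega' -> 'I_n)
    (hr' : independent_samples P' (optimal_probability_finest A B) r') :
  (expected_sq_error P A B Theta (optimal_probability A B Theta) r <=
   expected_sq_error P' A B (@finest_partition n)
     (optimal_probability_finest A B) r')%E.
Proof.
rewrite optimal_probability_finestE in hpo hr' *.
rewrite (expected_sq_error_optimal hc hTheta hpk hr).
rewrite (expected_sq_error_optimal hc (@finest_indexed_partition n) hpo hr').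
rewrite lee_fin ler_wpM2l ?invr_ge0 ?ler0n// lerD2r.
have sum_ge0 k' (T : 'I_k' -> {set 'I_n}) :
    (0 <= \sum_l frobenius_norm (cols_in A (T l) *m rows_in B (T l)))%R.
  by apply: sumr_ge0 => l _; apply: frobenius_norm_ge0.
rewrite ler_pXn2r ?nnegrE ?sum_ge0//.
under [leRHS]eq_bigr do rewrite frobenius_norm_finest_block.
rewrite -(sum_indexed_partition _ hTheta); apply: ler_sum => l _.
rewrite block_mulmx; apply: le_trans (frobenius_norm_sum _ _) _.
by apply: ler_sum => t _; rewrite frobenius_norm_outer.
Qed.
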